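(* For every positive integer $n$ there exists a non-trivial two-coloring $C$ of $\mathbb{Z}^d$ with $d = 2n^2 - n$ and $r(C) = n$; in particular $d = 2r(C)^2 - r(C)$.
   Context: A two-coloring $C$ of $\mathbb{Z}^d$ assigns to each lattice point one of two colors, red or blue. $C$ is non-trivial if the origin is red and, for each $i \in \{1,\dots,d\}$, there is at least one blue point on the $i$-th coordinate axis (a point all of whose coordinates other than the $i$-th are zero). For $x \in \mathbb{Z}^d$, the axis-sensitivity $r(C,x)$ is the number of indices $i \in \{1,\dots,d\}$ such that at least one of $x+e_i$, $x-e_i$ has a color different from that of $x$ ($e_i$ the $i$-th standard unit vector). The axis-sensitivity of $C$ is $r(C)=\max_{x\in\mathbb{Z}^d} r(C,x)$. *)

(* Defs.v *)
From mathcomp Require Import all_boot all_order all_algebra.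
From mathcomp Require Import boolp.
Set Implicit Arguments.
Unset Strict Implicit.
Unset Printing Implicit Defensive.
Import GRing.Theory.
Local Open Scope ring_scope.

Definition color : Type := bool.
Definition red : color := true.
Definition blue : color := false.

Definition coloring (d : nat) : Type := 'rV[int]_d -> color.

Definition unit_vec (d : nat) (i : 'I_d) : 'rV[int]_d := delta_mx 0 i.

Definition on_axis (d : nat) (i : 'I_d) (x : 'rV[int]_d) : Prop :=
  forall j : 'I_d, j != i -> x 0 j = 0.

Definition nontrivial (d : nat) (C : coloring d) : Prop :=
  C 0 = red /\
  forall i : 'I_d, exists x : 'rV[int]_d, on_axis i x /\ C x = blue.

Definition axis_sensitivity_at (d : nat) (C : coloring d) (x : 'rV[int]_d) : nat :=
  #|[set i : 'I_d | (C (x + unit_vec i) != C x) || (C (x - unit_vec i) != C x)]|.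

(* Every value of axis_sensitivity_at C is at most d, so the maximum over the
   infinite set Z^d is the largest k <= d that is attained. *)
Definition axis_sensitivity (d : nat) (C : coloring d) : nat :=
  (\max_(k < d.+1 | `[< exists x : 'rV[int]_d, axis_sensitivity_at C x = k >]) k)%N.

Lemma axis_sensitivity_at_le_dim (d : nat) (C : coloring d) (x : 'rV[int]_d) :
  (axis_sensitivity_at C x <= d)%N.
Proof. by rewrite -[leqRHS]card_ord max_card. Qed.

Lemma axis_sensitivity_ge (d : nat) (C : coloring d) (x : 'rV[int]_d) :
  (axis_sensitivity_at C x <= axis_sensitivity C)%N.
Proof.
have lt_d : (axis_sensitivity_at C x < d.+1)%N.
  by rewrite ltnS axis_sensitivity_at_le_dim.
apply: (leq_bigmax_cond (F := fun k : 'I_d.+1 => k : nat) (Ordinal lt_d)).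
by apply/asboolP; exists x.
Qed.

Lemma axis_sensitivity_attained (d : nat) (C : coloring d) :
  exists x : 'rV[int]_d, axis_sensitivity_at C x = axis_sensitivity C.
Proof.
have lt_d : (axis_sensitivity_at C 0 < d.+1)%N.
  by rewrite ltnS axis_sensitivity_at_le_dim.
rewrite /axis_sensitivity (bigmax_eq_arg (Ordinal lt_d)); last first.
  by apply/asboolP; exists 0.
case: arg_maxnP => [|k /asboolP[x xk] _]; first by apply/asboolP; exists 0.
by exists x.
Qed.

(* Main.v *)
Require Import Defs.
From mathcomp Require Import all_boot.
From mathcomp Require Import all_order all_algebra zify.

(** Split the [n (2n - 1)] axes into [n] groups of [2n - 1] and put a regular
    tournament on each group.  For each axis [i], paint blue the region
    [x_i >= 2], [x_j <= 0] for the [n - 1] out-neighbours [j] of [i]; the rest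
    is red.  A region constrains only [n] coordinates, so a blue point is
    sensitive along at most [n] axes.  Two regions of the same group disagree
    by at least 2 on some coordinate, so from a red point they cannot be
    entered along two different axes: a red point is sensitive along at most
    one axis per group. *)

Set Implicit Arguments.
Unset Strict Implicit.
Unset Printing Implicit Defensive.
Import Order.TTheory GRing.Theory Num.Theory.
Local Open Scope ring_scope.

Definition in_region (d : nat) (e : rel 'I_d) (i : 'I_d) (x : 'rV[int]_d) : bool :=
  (2 <= x 0 i) && [forall j, e i j ==> (x 0 j <= 0)].

Definition region_coloring (d : nat) (e : rel 'I_d) : coloring d :=
  fun x => ~~ [exists i, in_region e i x].

(** Treats both neighbours of [x] along axis [i] uniformly, through linear bounds that [lia] can
    use. *)
Definition axis_step (d : nat) (i : 'I_d) (x y : 'rV[int]_d) : Prop :=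
  (forall k, k != i -> y 0 k = x 0 k) /\ x 0 i - 1 <= y 0 i <= x 0 i + 1.

Lemma axis_stepD (d : nat) (i : 'I_d) (x : 'rV[int]_d) :
  axis_step i x (x + unit_vec i).
Proof.
split=> [k ki|]; rewrite !mxE !eqxx /=; last by lia.
by rewrite (negbTE ki) addr0.
Qed.

Lemma axis_stepB (d : nat) (i : 'I_d) (x : 'rV[int]_d) :
  axis_step i x (x - unit_vec i).
Proof.
split=> [k ki|]; rewrite !mxE !eqxx /=; last by lia.
by rewrite (negbTE ki) subr0.
Qed.

(** A region constrains each coordinate separately, and since the axes differ, every coordinate of
    [x] survives in [y] or in [z]. *)
Lemma in_region_two_steps (d : nat) (e : rel 'I_d) (a i j : 'I_d) (x y z : 'rV[int]_d) :
  i != j -> axis_step i x y -> axis_step j x z ->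
  in_region e a y -> in_region e a z -> in_region e a x.
Proof.
move=> ij [xy _] [xz _] /andP[ya /forallP yout] /andP[za /forallP zout].
have xyz k : x 0 k = y 0 k \/ x 0 k = z 0 k.
  have [->|ki] := eqVneq k i; first by right; rewrite xz.
  by left; rewrite xy.
apply/andP; split; first by case: (xyz a) => ->.
by apply/forallP => k; case: (xyz k) => ->.
Qed.

(** The regions of [a] and [b] require [y_b <= 0] and [z_b >= 2]. At most one of the two steps moves
    coordinate [b], and by at most 1, which cannot bridge a gap of 2. *)
Lemma region_separation (d : nat) (e : rel 'I_d) (a b i j : 'I_d) (x y z : 'rV[int]_d) :
  i != j -> axis_step i x y -> axis_step j x z -> e a b ->
  in_region e a y -> in_region e b z -> False.
Proof.
move=> ij [xy xyi] [xz xzj] eab /andP[_ /forallP/(_ b)].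
rewrite eab /= => yb /andP[zb _].
have [bi|bi] := eqVneq b i.
  have bj : b != j by rewrite bi.
  by move: (xz b bj) xyi; rewrite -bi; lia.
have := xy b bi.
have [bj|bj] := eqVneq b j; first by move: xzj; rewrite -bj; lia.
by have := xz b bj; lia.
Qed.

(** Sending each sensitive axis to the group of a region entered along it is injective: two axes
    entering the same region would put [x] inside it, and two distinct regions of one group are
    separated. *)
Lemma region_coloring_red_sensitivity (d n : nat) (e : rel 'I_d) (grp : 'I_d -> 'I_n)
    (x : 'rV[int]_d) :
  (forall i j, i != j -> grp i = grp j -> e i j || e j i) ->
  region_coloring e x -> (axis_sensitivity_at (region_coloring e) x <= n)%N.
Proof.
move=> e_total redx; rewrite /axis_sensitivity_at; set S := [set i | _].
pose entered i : pred 'I_d :=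
  fun a => in_region e a (x + unit_vec i) || in_region e a (x - unit_vec i).
(* The default [grp i] is never reached on [S]: as [x] is red, a color change along [i] means that
   some region is entered. *)
pose f i := oapp grp (grp i) [pick a | entered i a].
have fP i : i \in S ->
    exists a y, [/\ f i = grp a, axis_step i x y & in_region e a y].
  rewrite inE redx => Si; rewrite /f.
  case: pickP => [a /orP[ra|ra]|none].
  - by exists a, (x + unit_vec i); split=> //; apply: axis_stepD.
  - by exists a, (x - unit_vec i); split=> //; apply: axis_stepB.
  have [a ea] : exists a, entered i a.
    move: Si; rewrite /region_coloring /entered.
    case: existsP => [[a ra] _|_]; first by exists a; rewrite ra.
    case: existsP => [[a ra] _|//].
    by exists a; rewrite ra orbT.
  by rewrite none in ea.
have f_inj : {in S &, injective f}.
  move=> i j Si Sj fij; apply/eqP/negPn/negP => ij.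
  have [a [y [fa xy ya]]] := fP i Si.
  have [b [z [fb xz zb]]] := fP j Sj.
  have [ab|ab] := eqVneq a b.
    move/negP: redx; apply; apply/existsP; exists a.
    by apply: (in_region_two_steps ij xy xz ya); rewrite ab.
  have /orP[eab|eba] := e_total a b ab (etrans (esym fa) (etrans fij fb)).
    exact: (region_separation ij xy xz eab ya zb).
  by apply: (region_separation _ xz xy eba zb ya); rewrite eq_sym.
by rewrite -(card_in_imset f_inj) -[leqRHS]card_ord max_card.
Qed.

(** A step along an axis other than [a] and its out-neighbours does not touch the constraints of the
    region of [a], so the point stays blue. *)
Lemma region_coloring_blue_sensitivity (d : nat) (e : rel 'I_d) (a : 'I_d)
    (x : 'rV[int]_d) :
  in_region e a x ->
  (axis_sensitivity_at (region_coloring e) x <= #|[set j | e a j]|.+1)%N.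
Proof.
move=> xa; rewrite /axis_sensitivity_at.
have blue_of y : in_region e a y -> region_coloring e y = false.
  by move=> ya; apply/negbTE; rewrite negbK; apply/existsP; exists a.
have stay i y : i != a -> ~~ e a i -> axis_step i x y -> in_region e a y.
  move=> ia nei [xy _]; move: xa => /andP[xa /forallP xout].
  apply/andP; split; first by rewrite xy // eq_sym.
  apply/forallP => j; apply/implyP => eaj.
  rewrite xy; first by have := xout j; rewrite eaj.
  by apply: contraNneq nei => <-.
apply: (@leq_trans #|a |: [set j | e a j]|); last first.
  by rewrite cardsU1; case: (_ \notin _) => /=; lia.
apply/subset_leq_card/subsetP => i; rewrite !inE.
apply: contraTT; rewrite negb_or => /andP[ia nei].
rewrite (blue_of x xa) (blue_of (x + _)) ?(blue_of (x - _)) //.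
- exact: stay ia nei (axis_stepB i x).
- exact: stay ia nei (axis_stepD i x).
Qed.

Definition axis_point (d : nat) (a : 'I_d) : 'rV[int]_d :=
  \row_j (if j == a then 2%:Z else 0).

Lemma in_region_axis_point (d : nat) (e : rel 'I_d) (a : 'I_d) :
  irreflexive e -> in_region e a (axis_point a).
Proof.
move=> e_irr; rewrite /in_region mxE eqxx lexx /=.
apply/forallP => j; apply/implyP => eaj; rewrite mxE.
by case: eqP eaj => // ->; rewrite e_irr.
Qed.

(** The axis point is a corner of its region: all the constraints there are tight, so each
    constrained axis has a step that leaves the region, and no other region is within reach. *)
Lemma region_coloring_sensitivity_axis_point (d : nat) (e : rel 'I_d) (a : 'I_d) :
  irreflexive e ->
  (#|[set j | e a j]|.+1 <=
     axis_sensitivity_at (region_coloring e) (axis_point a))%N.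
Proof.
move=> e_irr; set p := axis_point a.
have bluep : region_coloring e p = false.
  by apply/negbTE; rewrite negbK; apply/existsP; exists a; apply: in_region_axis_point.
have -> : #|[set j | e a j]|.+1 = #|a |: [set j | e a j]|.
  by rewrite cardsU1 inE e_irr.
rewrite /axis_sensitivity_at bluep.
apply/subset_leq_card/subsetP => i; rewrite !inE => /orP[/eqP ->|eai].
  (* Stepping back along [a] leaves every coordinate at most 1, below the threshold of every
     region. *)
  apply/orP; right; rewrite eqbF_neg negbK; apply/existsP => -[b /andP[+ _]].
  by rewrite !mxE eqxx /=; case: (b == a).
have ia : i != a by apply: contraTneq eai => ->; rewrite e_irr.
(* Stepping forward along [i] makes coordinate [i] equal to 1. Only coordinate [a] reaches 2, and
   the region of [a] forbids a positive coordinate [i]. *)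
apply/orP; left; rewrite eqbF_neg negbK; apply/existsP => -[b /andP[pb /forallP/(_ i)]].
move: pb; rewrite !mxE !eqxx /= (negbTE ia).
case: (b =P a) => [-> _|_]; first by rewrite eai.
by case: (b == i).
Qed.

Lemma region_coloring_nontrivial (d : nat) (e : rel 'I_d) :
  irreflexive e -> nontrivial (region_coloring e).
Proof.
move=> e_irr; split.
  by apply/negP => /existsP[i /andP[]]; rewrite mxE.
move=> i; exists (axis_point i); split.
  by move=> j ji; rewrite mxE (negbTE ji).
apply/negbTE; rewrite negbK; apply/existsP; exists i.
exact: in_region_axis_point.
Qed.

(** The number of groups and the out-degree plus one are both [n], so the red and blue upper bounds
    agree, and an axis point attains them. *)
Lemma region_coloring_sensitivity (d n : nat) (e : rel 'I_d) (grp : 'I_d -> 'I_n) :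
  (0 < d)%N -> irreflexive e ->
  (forall i j, i != j -> grp i = grp j -> e i j || e j i) ->
  (forall i, #|[set j | e i j]|.+1 = n) ->
  axis_sensitivity (region_coloring e) = n.
Proof.
move=> d_gt0 e_irr e_total e_deg; apply/eqP; rewrite eqn_leq; apply/andP; split.
  have [x <-] := axis_sensitivity_attained (region_coloring e).
  have [redx|] := boolP (region_coloring e x).
    exact: region_coloring_red_sensitivity e_total redx.
  rewrite negbK => /existsP[a xa].
  by rewrite -[leqRHS](e_deg a); apply: region_coloring_blue_sensitivity.
rewrite -[leqLHS](e_deg (Ordinal d_gt0)).
exact: leq_trans (region_coloring_sensitivity_axis_point _ e_irr) (axis_sensitivity_ge _ _).
Qed.

(** The circulant regular tournament; the subtraction is modulo [2p + 1]. *)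
Definition rotational_tournament (p : nat) : rel 'I_p.*2.+1 :=
  fun a b => (0 < (b - a)%R <= p)%N.

Lemma rotational_tournament_irr (p : nat) : irreflexive (@rotational_tournament p).
Proof. by move=> a; rewrite /rotational_tournament subrr. Qed.

Lemma rotational_tournament_total (p : nat) (a b : 'I_p.*2.+1) :
  a != b -> rotational_tournament a b || rotational_tournament b a.
Proof.
rewrite eq_sym -subr_eq0 /rotational_tournament -(opprB b a).
move: (b - a) => c; rewrite -val_eqE /= => c0.
(* For nonzero [c], one of [c] and [2p + 1 - c] lies between 1 and [p]. *)
have := ltn_ord c; rewrite modn_small; lia.
Qed.

Lemma rotational_tournament_outdegree (p : nat) (a : 'I_p.*2.+1) :
  #|[set b | rotational_tournament a b]| = p.
Proof.
(* The out-neighbours are [a + 1, ..., a + p], distinct because [p < 2p + 1]. *)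
have -> : [set b | rotational_tournament a b] =
    (fun k : 'I_p => a + inord k.+1) @: [set: 'I_p].
  apply/setP => b; rewrite inE; apply/idP/imsetP => [/andP[gt0 lep]|[k _ ->]].
    have ltp : ((b - a)%R.-1 < p)%N by lia.
    exists (Ordinal ltp); first by [].
    have -> : inord (Ordinal ltp).+1 = b - a.
      by rewrite -[RHS]inord_val; congr inord; apply: prednK.
    by rewrite addrC subrK.
  by rewrite /rotational_tournament addrC addKr inordK; have := ltn_ord k; lia.
rewrite card_imset ?cardsT ?card_ord // => k l /addrI /(congr1 val).
rewrite /= !inordK; try by [have := ltn_ord k; lia | have := ltn_ord l; lia].
by case=> /val_inj.
Qed.

Local Close Scope ring_scope.

Theorem theorem3 (n : nat) (hn : 0 < n) :
  exists (d : nat) (C : coloring d),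
    [/\ d = 2 * n ^ 2 - n,
        nontrivial C,
        axis_sensitivity C = n
      & d = 2 * axis_sensitivity C ^ 2 - axis_sensitivity C].
Proof.
case: n hn => // p _.
(* With [n = p + 1], an axis is a pair of one of [n] groups and one of [2n - 1] tournament vertices,
   numbered through [enum_val]. *)
pose T : finType := ('I_p.+1 * 'I_p.*2.+1)%type.
pose e : rel 'I_#|T| := fun i j =>
  ((enum_val i).1 == (enum_val j).1) &&
  rotational_tournament (enum_val i).2 (enum_val j).2.
pose grp (i : 'I_#|T|) : 'I_p.+1 := (enum_val i).1.
have dE : #|T| = 2 * p.+1 ^ 2 - p.+1 by rewrite card_prod !card_ord; nia.
have e_irr : irreflexive e by move=> i; rewrite /e rotational_tournament_irr andbF.
have e_total i j : i != j -> grp i = grp j -> e i j || e j i.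
  rewrite /e /grp => ij gij; rewrite gij eqxx /=.
  apply: rotational_tournament_total; apply: contra ij => /eqP tij.
  by apply/eqP/enum_val_inj; apply/eqP; rewrite -pair_eqE /= gij tij !eqxx.
have e_deg i : #|[set j | e i j]|.+1 = p.+1.
  congr _.+1; rewrite -[RHS](rotational_tournament_outdegree (enum_val i).2).
  rewrite -[RHS](card_imset (f := fun b => enum_rank ((enum_val i).1, b) : 'I_#|T|)).
    apply: eq_card => j; apply/idP/imsetP => [|[b + ->]].
      rewrite inE => /andP[/eqP -> eij]; exists (enum_val j).2; first by rewrite inE.
      by rewrite -surjective_pairing enum_valK.
    by rewrite !inE /e enum_rankK eqxx.
  by move=> b c /enum_rank_inj[].
have sensE : axis_sensitivity (region_coloring e) = p.+1.
  apply: region_coloring_sensitivity e_irr e_total e_deg.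
  by rewrite card_prod !card_ord.
exists #|T|, (region_coloring e); split=> //; last by rewrite sensE.
exact: region_coloring_nontrivial.
Qed.
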